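(* Let $G$ be a connected graph on $n$ vertices with Laplacian matrix $L=[l_{ij}]$. Then every nonzero eigenvalue of $L$ is also an eigenvalue of each of the matrices $$L(k)=L(k|k)-e\,l(k)^T,\qquad k=1,2,\ldots,n.$$
   Context: Graphs are simple, finite and undirected. $L=D-A$, where $A$ is the adjacency matrix and $D$ the diagonal matrix of vertex degrees. $L(k|k)$ is the principal submatrix of $L$ obtained by deleting the $k$-th row and column, $l(k)^T=[l_{k1},\ldots,l_{k,k-1},l_{k,k+1},\ldots,l_{kn}]$ is the $k$-th row of $L$ with its $k$-th entry deleted, and $e$ is the all-ones column vector of length $n-1$. *)

(* Defs.v *)
From HB Require Import structures.
From mathcomp Require Export all_boot all_order all_algebra.

Set Implicit Arguments.
Unset Strict Implicit.
Unset Printing Implicit Defensive.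

Import GRing.Theory.
Local Open Scope ring_scope.

Definition simple_graph (n : nat) (g : rel 'I_n) : Prop :=
  symmetric g /\ irreflexive g.

Definition connected_graph (n : nat) (g : rel 'I_n) : Prop :=
  forall i j : 'I_n, connect g i j.

Definition adjacency (R : numFieldType) (n : nat) (g : rel 'I_n) : 'M[R]_n :=
  \matrix_(i, j) (g i j)%:R.

Definition degree (n : nat) (g : rel 'I_n) (i : 'I_n) : nat :=
  #|[set j | g i j]|.

Definition degree_mx (R : numFieldType) (n : nat) (g : rel 'I_n) : 'M[R]_n :=
  diag_mx (\row_i (degree g i)%:R).

Definition laplacian (R : numFieldType) (n : nat) (g : rel 'I_n) : 'M[R]_n :=
  degree_mx R g - adjacency R g.

(* M(k|k) *)
Definition principal_submx (R : numFieldType) (n : nat) (M : 'M[R]_n)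
    (k : 'I_n) : 'M[R]_n.-1 :=
  row' k (col' k M).

(* l(k), as a column vector: the transpose of the k-th row of M without its
   k-th entry. *)
Definition punctured_row (R : numFieldType) (n : nat) (M : 'M[R]_n)
    (k : 'I_n) : 'cV[R]_n.-1 :=
  (col' k (row k M))^T.

(* M(k) = M(k|k) - e l(k)^T, with e the all-ones column vector. *)
Definition reduced_mx (R : numFieldType) (n : nat) (M : 'M[R]_n)
    (k : 'I_n) : 'M[R]_n.-1 :=
  principal_submx M k - (const_mx 1 : 'cV[R]_n.-1) *m (punctured_row M k)^T.

(* Main.v *)
(** Since [L e = 0], a left eigenvector [v] of [L] for [lambda <> 0] has entries
    summing to zero, so [v_k] is minus the sum of the other entries.  Hence
    deleting the [k]-th entry of [v] yields a left eigenvector of [L(k)]: the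
    term [- e l(k)^T] contributes exactly the missing [v_k l(k)^T]. *)
Require Import Defs.
From mathcomp Require Import all_boot all_order all_algebra.

Import GRing.Theory.
Local Open Scope ring_scope.

Lemma laplacian_row_sum (R : numFieldType) (n : nat) (g : rel 'I_n) (i : 'I_n) :
  \sum_j laplacian R g i j = 0.
Proof.
under eq_bigr do rewrite !mxE.
rewrite big_split /= sumrN (bigD1 i) //= eqxx mulr1n big1 => [|j ji]; last first.
  by rewrite eq_sym (negbTE ji).
rewrite addr0 -natr_sum /degree -sum1dep_card big_mkcond /=.
by under eq_bigr do rewrite -mulrb; rewrite subrr.
Qed.

Lemma eigenvalue_reduced_mx (R : numFieldType) (n : nat) (M : 'M[R]_n)
    (lambda : R) (k : 'I_n) :
  (forall i, \sum_j M i j = 0) -> lambda != 0 ->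
  eigenvalue M lambda -> eigenvalue (reduced_mx M k) lambda.
Proof.
move=> M_rows lambda_neq0 /eigenvalueP[v vM v_neq0].
have vME j : \sum_i v 0 i * M i j = lambda * v 0 j.
  by move/rowP/(_ j): vM; rewrite !mxE.
(* Multiplying [v *m M = lambda *: v] on the right by the all-ones vector, which [M] kills, gives
   [lambda] times this sum equal to 0. *)
have sum_v : \sum_j v 0 j = 0.
  apply: (mulfI lambda_neq0); rewrite mulr0 mulr_sumr.
  under eq_bigr do rewrite -vME.
  by rewrite exchange_big big1 // => i _; rewrite -mulr_sumr M_rows mulr0.
have v_k : v 0 k = - \sum_i v 0 (lift k i).
  by move: sum_v; rewrite (bigD1_ord k) //= => /eqP; rewrite addr_eq0 => /eqP.
apply/eigenvalueP; exists (col' k v).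
  apply/rowP=> j; rewrite /reduced_mx mulmxBr !mxE.
  (* The right-hand side unfolds to an entry of [v *m M]; its [k]-th term, after substituting [v_k],
     is the rank-one correction. *)
  rewrite -vME (bigD1_ord k) //= v_k mulNr addrC; congr (_ + _).
    by rewrite mulr_suml; congr (- _); apply: eq_bigr => i _;
       rewrite !mxE big_ord1 !mxE mul1r.
  by apply: eq_bigr => i _; rewrite !mxE.
(* If the punctured vector vanished, so would [v 0 k], being minus the sum of its entries, and then
   [v = 0]. *)
apply: contraNneq v_neq0 => v'0; apply/eqP/rowP=> j; rewrite mxE.
have v_lift i : v 0 (lift k i) = 0 by move/rowP/(_ i): v'0; rewrite !mxE.
by case: (unliftP k j) => [i|] ->; rewrite ?v_k ?v_lift // big1 ?oppr0.
Qed.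

Theorem theorem5p1 (R : numFieldType) (n : nat) (g : rel 'I_n)
    (g_simple : simple_graph g) (g_connected : connected_graph g)
    (lambda : R) (lambda_neq0 : lambda != 0)
    (lambda_eig : eigenvalue (laplacian R g) lambda) (k : 'I_n) :
  eigenvalue (reduced_mx (laplacian R g) k) lambda.
Proof.
by apply: eigenvalue_reduced_mx => // i; apply: laplacian_row_sum.
Qed.
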